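(* Let $H$ be a Hopf algebra over a field $\Bbbk$, $(C,\leftharpoonup)$ a right partial $H$-module coalgebra, $(D,\blacktriangleleft)$ a right $H$-module coalgebra, $\theta\colon C\to D$ a coalgebra monomorphism, and $\pi\colon D\to\theta(C)$ a comultiplicative projection onto $\theta(C)$. Let $\varphi\colon C^*\to D^*$ be the linear map $\varphi(\alpha)=\alpha\circ\theta^{-1}\circ\pi$, where $\theta^{-1}\colon\theta(C)=\pi(D)\to C$ is the inverse of $\theta$ on its image. Then $(\theta(C)\blacktriangleleft H,\theta,\pi)$ is a globalization for the partial module coalgebra $C$ if and only if $(H\triangleright\varphi(C^* ),\varphi)$ is a globalization for the partial module algebra $C^*$.
   Context: All objects are over a field $\Bbbk$; $\Delta(c)=c_1\otimes c_2$ and $\varepsilon$ denotes the counit. Duals $C^*,D^*$ of coalgebras are algebras under the convolution product $(\alpha*\beta)(c)=\alpha(c_1)\beta(c_2)$. Right $H$-module coalgebra $(D,\blacktriangleleft)$: $D$ a coalgebra, $\blacktriangleleft\colon D\otimes H\to D$ linear with $d\blacktriangleleft 1_H=d$, $\Delta(d\blacktriangleleft h)=d_1\blacktriangleleft h_1\otimes d_2\blacktriangleleft h_2$, $(d\blacktriangleleft h)\blacktriangleleft g=d\blacktriangleleft hg$. Right partial $H$-module coalgebra $(C,\leftharpoonup)$: $C$ a coalgebra, $\leftharpoonup\colon C\otimes H\to C$ linear with $c\leftharpoonup 1_H=c$, $\Delta(c\leftharpoonup h)=c_1\leftharpoonup h_1\otimes c_2\leftharpoonup h_2$, $(c\leftharpoonup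 h)\leftharpoonup g=\varepsilon(c_1\leftharpoonup h_1)(c_2\leftharpoonup h_2g)$. Left $H$-module algebra $(B,\triangleright)$: $B$ an algebra, $\triangleright\colon H\otimes B\to B$ linear with $1_H\triangleright a=a$, $h\triangleright(ab)=(h_1\triangleright a)(h_2\triangleright b)$, $h\triangleright(k\triangleright a)=(hk)\triangleright a$. Left partial $H$-module algebra $(A,\rightharpoonup)$: $A$ a unital algebra, $\rightharpoonup\colon H\otimes A\to A$ linear with $1_H\rightharpoonup a=a$, $h\rightharpoonup(ab)=(h_1\rightharpoonup a)(h_2\rightharpoonup b)$, $h\rightharpoonup(k\rightharpoonup a)=(h_1\rightharpoonup 1_A)(h_2k\rightharpoonup a)$. $C^*$ is a left partial $H$-module algebra via $(h\rightharpoonup\alpha)(c)=\alpha(c\leftharpoonup h)$, and $D^*$ is a left $H$-module algebra via $(h\triangleright\xi)(d)=\xi(d\blacktriangleleft h)$; the product and action on $H\triangleright\varphi(C^* )$ are those of $D^*$. $\theta(C)\blacktriangleleft H$ (resp. $H\triangleright\varphi(C^* )$) is the linear span of all $\theta(c)\blacktriangleleft h$ (resp. $h\triangleright\varphi(\alpha)$). A projection is an idempotent linear map; $\pi$ is comultiplicative if $\Delta\circ\pi=(\pi\otimes\pi)\circ\Delta$. A globalization of a right partial $H$-module coalgebra $C$ is a triple $(E,\theta,\pi)$, with $E$ a right $H$-module coalgebra via $\blacktriangleleft$, $\theta\colon C\to E$ a coalgebra monomorphism and $\pi$ a comultiplicative projection from $E$ onto $\theta(C)$, such that for all $h\in H$,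 $c\in C$, $d\in E$: $\pi[\pi(d)\blacktriangleleft h]=\pi[\varepsilon(\pi(d_1))d_2\blacktriangleleft h]$; $\theta(c\leftharpoonup h)=\pi(\theta(c)\blacktriangleleft h)$; and $E=\theta(C)\blacktriangleleft H$. A globalization (enveloping action) of a left partial $H$-module algebra $A$ is a pair $(B,\varphi)$, with $B$ a left $H$-module algebra and $\varphi\colon A\to B$ an algebra monomorphism (multiplicative and injective), such that: $\varphi(A)$ is a right ideal of $B$; the partial action on $A$ is equivalent to the induced one on $\varphi(A)$, i.e. $\varphi(h\rightharpoonup a)=\varphi(1_A)(h\triangleright\varphi(a))$ for all $h\in H$, $a\in A$; and $B=H\triangleright\varphi(A)$.
   Formalization: In the globalization of C, the law π[π(d)◁h]=π[ε(π(d₁))d₂◁h] is required for all d in D, the domain of π, not only for d in θ(C)◁H; with d only in θ(C)◁H the forward implication is false when D is larger. *)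

(* Defs.v *)
From HB Require Import structures.
From mathcomp Require Import all_boot all_algebra.
From mathcomp Require Import boolp classical_sets.
Set Implicit Arguments.
Unset Strict Implicit.
Unset Printing Implicit Defensive.
Import GRing.Theory.
Local Open Scope quotient_scope.
Local Open Scope classical_set_scope.
Local Open Scope ring_scope.

Declare Scope coalg_scope.
Delimit Scope coalg_scope with coalg.
Local Open Scope coalg_scope.

Reserved Notation "u ⊗ v" (at level 40, left associativity).
Reserved Notation "x ∗ y" (at level 40, left associativity).

Definition subspace (k : fieldType) (V : lmodType k) (E : set V) : Prop :=
  E 0 /\ forall (a : k) u v, E u -> E v -> E (a *: u + v).

Definition lspan (k : fieldType) (V : lmodType k) (X : set V) : set V :=
  [set v | exists s : seq (k * V),
     (forall p, p \in s -> X p.2) /\ v = \sum_(p <- s) p.1 *: p.2].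

(* Tensor product of arbitrary (possibly infinite-dimensional) vector spaces:
   formal sums of pairs, two of them being identified when no bilinear map
   separates them. *)
Section Tensor.
Variables (k : fieldType) (U V : lmodType k).

Definition tens_eval (W : lmodType k) (f : U -> V -> W) (s : seq (U * V)) : W :=
  \sum_(p <- s) f p.1 p.2.

Definition tens_rel : rel (seq (U * V)) := fun s t =>
  `[< forall (W : lmodType k) (f : {bilinear U -> V -> W}),
        tens_eval f s = tens_eval f t >].

Lemma tens_rel_refl : reflexive tens_rel.
Proof. by move=> s; apply/asboolP. Qed.
Lemma tens_rel_sym : symmetric tens_rel.
Proof.
by move=> s t; apply/asboolP/asboolP=> e W f; rewrite e.
Qed.
Lemma tens_rel_trans : transitive tens_rel.
Proof.
by move=> t s r /asboolP e1 /asboolP e2; apply/asboolP => W f; rewrite e1 e2.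
Qed.

Canonical tens_equiv := EquivRel tens_rel tens_rel_refl tens_rel_sym tens_rel_trans.

Definition tensor : Type := {eq_quot tens_equiv}.
HB.instance Definition _ := Choice.on tensor.

Definition tclass (s : seq (U * V)) : tensor := (\pi_{eq_quot tens_equiv} s)%qT.
Definition trepr (t : tensor) : seq (U * V) := repr (t : {eq_quot tens_equiv}).

(* The linear map on the tensor product induced by a bilinear f; the value is
   only meaningful for bilinear f, see tlift_tens and tlift_is_linear. *)
Definition tlift (W : lmodType k) (f : U -> V -> W) (t : tensor) : W :=
  tens_eval f (trepr t).

Lemma treprK t : tclass (trepr t) = t.
Proof. exact: reprK. Qed.

Lemma tclass_eq s t :
  (forall (W : lmodType k) (f : {bilinear U -> V -> W}),
     tens_eval f s = tens_eval f t) -> tclass s = tclass t.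
Proof. by move=> e; apply/eqmodP/asboolP. Qed.

Lemma tlift_class (W : lmodType k) (f : {bilinear U -> V -> W}) s :
  tlift f (tclass s) = tens_eval f s.
Proof.
have /eqmodP/asboolP : trepr (tclass s) = s %[mod {eq_quot tens_equiv}]%qT.
  exact: reprK.
exact.
Qed.

Lemma tensor_ext (s t : tensor) :
  (forall (W : lmodType k) (f : {bilinear U -> V -> W}), tlift f s = tlift f t) ->
  s = t.
Proof. by move=> e; rewrite -[s]treprK -[t]treprK; apply: tclass_eq. Qed.

Definition tens_add (s t : tensor) := tclass (trepr s ++ trepr t).
Definition tens_scale (a : k) (s : tensor) :=
  tclass [seq (a *: p.1, p.2) | p <- trepr s].
Definition tens_opp (s : tensor) := tens_scale (- 1) s.
Definition tens_zero : tensor := tclass [::].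

Section Eval.
Variables (W : lmodType k) (f : {bilinear U -> V -> W}).
Lemma tlift_add s t : tlift f (tens_add s t) = tlift f s + tlift f t.
Proof. by rewrite tlift_class /tens_eval big_cat. Qed.
Lemma tlift_scale a s : tlift f (tens_scale a s) = a *: tlift f s.
Proof.
rewrite tlift_class /tens_eval big_map scaler_sumr.
by apply: eq_bigr => p _ /=; rewrite linearZl_LR.
Qed.
Lemma tlift_zero : tlift f tens_zero = 0.
Proof. by rewrite tlift_class /tens_eval big_nil. Qed.
End Eval.

Let tE := (tlift_add, tlift_scale, tlift_zero).

Lemma tens_addA : associative tens_add.
Proof. by move=> s t r; apply: tensor_ext => W f; rewrite !tE addrA. Qed.
Lemma tens_addC : commutative tens_add.
Proof. by move=> s t; apply: tensor_ext => W f; rewrite !tE addrC. Qed.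
Lemma tens_add0 : left_id tens_zero tens_add.
Proof. by move=> s; apply: tensor_ext => W f; rewrite !tE add0r. Qed.
Lemma tens_addN : left_inverse tens_zero tens_opp tens_add.
Proof. by move=> s; apply: tensor_ext => W f; rewrite !tE scaleN1r addNr. Qed.
HB.instance Definition _ :=
  GRing.isZmodule.Build tensor tens_addA tens_addC tens_add0 tens_addN.

Lemma tens_scaleA a b s : tens_scale a (tens_scale b s) = tens_scale (a * b) s.
Proof. by apply: tensor_ext => W f; rewrite !tE scalerA. Qed.
Lemma tens_scale1 : left_id 1 tens_scale.
Proof. by move=> s; apply: tensor_ext => W f; rewrite !tE scale1r. Qed.
Lemma tens_scaleDr : right_distributive tens_scale +%R.
Proof. by move=> a s t; apply: tensor_ext => W f; rewrite !tE scalerDr. Qed.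
Lemma tens_scaleDl s : {morph tens_scale^~ s : a b / a + b}.
Proof. by move=> a b; apply: tensor_ext => W f; rewrite !tE scalerDl. Qed.
HB.instance Definition _ := GRing.Zmodule_isLmodule.Build k tensor
  tens_scaleA tens_scale1 tens_scaleDr tens_scaleDl.

Definition tens (u : U) (v : V) : tensor := tclass [:: (u, v)].

Lemma tlift_tens (W : lmodType k) (f : {bilinear U -> V -> W}) u v :
  tlift f (tens u v) = f u v.
Proof. by rewrite tlift_class /tens_eval big_seq1. Qed.

Lemma tlift_is_linear (W : lmodType k) (f : {bilinear U -> V -> W}) :
  linear (tlift f).
Proof. by move=> a s t; rewrite [LHS]tlift_add tlift_scale. Qed.

Lemma tens_is_bilinear : bilinear_for *:%R *:%R tens.
Proof.
split=> [v|u] a x y; apply: tensor_ext => W f; rewrite tlift_is_linear !tlift_tens.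
- by rewrite linearPl.
- by rewrite linearPr.
Qed.
HB.instance Definition _ :=
  bilinear_isBilinear.Build k U V tensor *:%R *:%R tens tens_is_bilinear.

End Tensor.

Notation "u ⊗ v" := (tens u v) : coalg_scope.

Section TensorTheory.
Variable k : fieldType.
Implicit Types U V W : lmodType k.

Lemma tliftT U V W (f : U -> V -> W) (bf : bilinear_for *:%R *:%R f) u v :
  tlift f (u ⊗ v) = f u v.
Proof.
pose m := bilinear_isBilinear.Build k U V W *:%R *:%R f bf.
pose F : {bilinear U -> V -> W} := HB.pack f m.
exact: (tlift_tens F).
Qed.

Lemma tliftP U V W (f : U -> V -> W) (bf : bilinear_for *:%R *:%R f) :
  linear (tlift f).
Proof.
pose m := bilinear_isBilinear.Build k U V W *:%R *:%R f bf.
pose F : {bilinear U -> V -> W} := HB.pack f m.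
exact: (tlift_is_linear F).
Qed.

Lemma tlift_comp U V W W' (g : {linear W -> W'}) (f : U -> V -> W) t :
  g (tlift f t) = tlift (fun a b => g (f a b)) t.
Proof. by rewrite /tlift /tens_eval linear_sum. Qed.

Lemma eq_tlift U V W (f g : U -> V -> W) :
  (forall a b, f a b = g a b) -> tlift f =1 tlift g.
Proof. by move=> e t; rewrite /tlift /tens_eval; apply: eq_bigr => p _. Qed.

Lemma tlift_exchange U V U' V' W (f : U -> V -> U' -> V' -> W) s t :
  tlift (fun a b => tlift (fun c d => f a b c d) t) s =
  tlift (fun c d => tlift (fun a b => f a b c d) s) t.
Proof. exact: exchange_big. Qed.

Lemma tlift_tlift U V U' V' W (f : U -> V -> W) (g : U' -> V' -> tensor U V) t :
  bilinear_for *:%R *:%R f ->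
  tlift f (tlift g t) = tlift (fun a b => tlift f (g a b)) t.
Proof.
move=> bf; pose m := GRing.isLinear.Build k _ _ _ _ (tliftP bf).
pose F : {linear tensor U V -> W} := HB.pack (tlift f) m.
exact: (tlift_comp F).
Qed.

End TensorTheory.

HB.mixin Record isCoalgebra (k : fieldType) C of GRing.Lmodule k C := {
  coprod_subdef : {linear C -> tensor C C};
  counit_subdef : {scalar C};
  coprodA_subproof : forall c,
    tlift (fun a b => tlift (fun a1 a2 => a1 ⊗ (a2 ⊗ b)) (coprod_subdef a))
      (coprod_subdef c) =
    tlift (fun a b => a ⊗ coprod_subdef b) (coprod_subdef c);
  counitl_subproof : forall c,
    tlift (fun a b => counit_subdef a *: b) (coprod_subdef c) = c;
  counitr_subproof : forall c,
    tlift (fun a b => counit_subdef b *: a) (coprod_subdef c) = c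
}.
#[short(type="coalgType")]
HB.structure Definition Coalgebra (k : fieldType) :=
  {C of GRing.Lmodule k C & isCoalgebra k C}.

Section CoalgebraTheory.
Variables (k : fieldType) (C : coalgType k).
Definition coprod : {linear C -> tensor C C} := coprod_subdef.
Definition counit : {scalar C} := counit_subdef.
Lemma coprodA c :
  tlift (fun a b => tlift (fun a1 a2 => a1 ⊗ (a2 ⊗ b)) (coprod a)) (coprod c) =
  tlift (fun a b => a ⊗ coprod b) (coprod c).
Proof. exact: coprodA_subproof. Qed.
Lemma counitl c : tlift (fun a b => counit a *: b) (coprod c) = c.
Proof. exact: counitl_subproof. Qed.
Lemma counitr c : tlift (fun a b => counit b *: a) (coprod c) = c.
Proof. exact: counitr_subproof. Qed.
End CoalgebraTheory.
Arguments coprod {k C}.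
Arguments counit {k C}.

(* Sweedler notation: sweedler c f stands for the sum of the f c_1 c_2. *)
Definition sweedler (k : fieldType) (C : coalgType k) (W : lmodType k)
    (c : C) (f : C -> C -> W) : W :=
  tlift f (coprod c).

HB.mixin Record isHopfAlgebra (k : fieldType) H
    of GRing.Algebra k H & Coalgebra k H := {
  antipode_subdef : {linear H -> H};
  coprod1_subproof : coprod (1 : H) = 1 ⊗ 1;
  coprodM_subproof : forall x y : H, coprod (x * y) =
    sweedler x (fun x1 x2 => sweedler y (fun y1 y2 => (x1 * y1) ⊗ (x2 * y2)));
  counit1_subproof : counit (1 : H) = 1;
  counitM_subproof : forall x y : H, counit (x * y) = counit x * counit y;
  antipodel_subproof : forall h : H,
    sweedler h (fun h1 h2 => antipode_subdef h1 * h2) = counit h *: 1;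
  antipoder_subproof : forall h : H,
    sweedler h (fun h1 h2 => h1 * antipode_subdef h2) = counit h *: 1
}.
#[short(type="hopfAlgType")]
HB.structure Definition HopfAlgebra (k : fieldType) :=
  {H of GRing.Algebra k H & Coalgebra k H & isHopfAlgebra k H}.

Section HopfAlgebraTheory.
Variables (k : fieldType) (H : hopfAlgType k).
Implicit Types h x y : H.
Definition antipode : {linear H -> H} := antipode_subdef.
Lemma coprod1 : coprod (1 : H) = 1 ⊗ 1.
Proof. exact: coprod1_subproof. Qed.
Lemma coprodM x y : coprod (x * y) =
  sweedler x (fun x1 x2 => sweedler y (fun y1 y2 => (x1 * y1) ⊗ (x2 * y2))).
Proof. exact: coprodM_subproof. Qed.
Lemma counit1 : counit (1 : H) = 1.
Proof. exact: counit1_subproof. Qed.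
Lemma counitM x y : counit (x * y) = counit x * counit y.
Proof. exact: counitM_subproof. Qed.
Lemma antipodel h : sweedler h (fun h1 h2 => antipode h1 * h2) = counit h *: 1.
Proof. exact: antipodel_subproof. Qed.
Lemma antipoder h : sweedler h (fun h1 h2 => h1 * antipode h2) = counit h *: 1.
Proof. exact: antipoder_subproof. Qed.
End HopfAlgebraTheory.
Arguments antipode {k H}.

(* algType requires a unit with 1 != 0. Neither is wanted here: the dual of the
   zero coalgebra is the zero algebra, and the globalization of a partial action
   need not have a unit. *)
HB.mixin Record isAssocAlgebra (k : fieldType) A of GRing.Lmodule k A := {
  amul_subdef : {bilinear A -> A -> A};
  amulA_subproof : forall x y z,
    amul_subdef x (amul_subdef y z) = amul_subdef (amul_subdef x y) z
}.
#[short(type="assocAlgType")]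
HB.structure Definition AssocAlgebra (k : fieldType) :=
  {A of GRing.Lmodule k A & isAssocAlgebra k A}.

Definition amul (k : fieldType) (A : assocAlgType k) : {bilinear A -> A -> A} :=
  amul_subdef.
Arguments amul {k A}.
Lemma amulA (k : fieldType) (A : assocAlgType k) : associative (@amul k A).
Proof. exact: amulA_subproof. Qed.

HB.mixin Record isUnitalAlgebra (k : fieldType) A of AssocAlgebra k A := {
  aone : A;
  amul1l : forall x : A, amul aone x = x;
  amul1r : forall x : A, amul x aone = x
}.
#[short(type="unitalAlgType")]
HB.structure Definition UnitalAlgebra (k : fieldType) :=
  {A of AssocAlgebra k A & isUnitalAlgebra k A}.

Notation "x ∗ y" := (amul x y) : coalg_scope.

Section Actions.
Variables (k : fieldType) (H : hopfAlgType k).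

Record module_coalgebra (D : coalgType k) := ModuleCoalgebra {
  mc_act :> {bilinear D -> H -> D};
  mc_act1 : forall d, mc_act d 1 = d;
  mc_coprod : forall d h, coprod (mc_act d h) =
    sweedler d (fun d1 d2 => sweedler h (fun h1 h2 =>
      mc_act d1 h1 ⊗ mc_act d2 h2));
  mc_actA : forall d h g, mc_act (mc_act d h) g = mc_act d (h * g)
}.

Record partial_module_coalgebra (C : coalgType k) := PartialModuleCoalgebra {
  pmc_act :> {bilinear C -> H -> C};
  pmc_act1 : forall c, pmc_act c 1 = c;
  pmc_coprod : forall c h, coprod (pmc_act c h) =
    sweedler c (fun c1 c2 => sweedler h (fun h1 h2 =>
      pmc_act c1 h1 ⊗ pmc_act c2 h2));
  pmc_actA : forall c h g, pmc_act (pmc_act c h) g =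
    sweedler c (fun c1 c2 => sweedler h (fun h1 h2 =>
      counit (pmc_act c1 h1) *: pmc_act c2 (h2 * g)))
}.

Record module_algebra (B : assocAlgType k) := ModuleAlgebra {
  ma_act :> {bilinear H -> B -> B};
  ma_act1 : forall a, ma_act 1 a = a;
  ma_actM : forall h a b, ma_act h (a ∗ b) =
    sweedler h (fun h1 h2 => ma_act h1 a ∗ ma_act h2 b);
  ma_actA : forall h g a, ma_act h (ma_act g a) = ma_act (h * g) a
}.

Record partial_module_algebra (A : unitalAlgType k) := PartialModuleAlgebra {
  pma_act :> {bilinear H -> A -> A};
  pma_act1 : forall a, pma_act 1 a = a;
  pma_actM : forall h a b, pma_act h (a ∗ b) =
    sweedler h (fun h1 h2 => pma_act h1 a ∗ pma_act h2 b);
  pma_actA : forall h g a, pma_act h (pma_act g a) =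
    sweedler h (fun h1 h2 => pma_act h1 aone ∗ pma_act (h2 * g) a)
}.

End Actions.

Section Dual.
Variables (k : fieldType) (U : lmodType k).

Definition dual : Type := {scalar U}.
HB.instance Definition _ := gen_eqMixin dual.
HB.instance Definition _ := gen_choiceMixin dual.

Definition dual_fun (a : dual) : {scalar U} := a.
Coercion dual_fun : dual >-> GRing.Linear.type.

Lemma dualP (a b : dual) : (forall x, a x = b x) -> a = b.
Proof.
case: a => f cf; case: b => g cg /= e.
have {}e : f = g by apply/funext.
case: _ / e cg => cg; congr GRing.Linear.Pack.
case: cf => -[a1] [a2]; case: cg => -[b1] [b2].
by congr GRing.Linear.Class; congr (_ _); apply: Prop_irrelevance.
Qed.
Definition mkdual (f : U -> k) (lf : scalar f) : dual :=
  let m := GRing.isLinear.Build k U k *%R f lf in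
  (HB.pack f m : {scalar U}).

Fact dual_zero_scalar : scalar (fun _ : U => 0 : k).
Proof. by move=> a x y; rewrite mulr0 addr0. Qed.
Fact dual_add_scalar (a b : dual) : scalar (fun x => a x + b x).
Proof. by move=> c x y; rewrite !linearP mulrDr addrACA. Qed.
Fact dual_scale_scalar (c : k) (a : dual) : scalar (fun x => c * a x).
Proof. by move=> d x y; rewrite linearP mulrDr mulrCA. Qed.

Definition dual_zero := mkdual dual_zero_scalar.
Definition dual_add a b := mkdual (dual_add_scalar a b).
Definition dual_scale c a := mkdual (dual_scale_scalar c a).
Definition dual_opp a := dual_scale (- 1) a.

Fact dual_addA : associative dual_add.
Proof. by move=> a b c; apply: dualP => x /=; rewrite addrA. Qed.
Fact dual_addC : commutative dual_add.
Proof. by move=> a b; apply: dualP => x /=; rewrite addrC. Qed.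
Fact dual_add0 : left_id dual_zero dual_add.
Proof. by move=> a; apply: dualP => x /=; rewrite add0r. Qed.
Fact dual_addN : left_inverse dual_zero dual_opp dual_add.
Proof. by move=> a; apply: dualP => x /=; rewrite mulN1r addNr. Qed.
HB.instance Definition _ :=
  GRing.isZmodule.Build dual dual_addA dual_addC dual_add0 dual_addN.

Fact dual_scaleA a b s : dual_scale a (dual_scale b s) = dual_scale (a * b) s.
Proof. by apply: dualP => x /=; rewrite mulrA. Qed.
Fact dual_scale1 : left_id 1 dual_scale.
Proof. by move=> s; apply: dualP => x /=; rewrite mul1r. Qed.
Fact dual_scaleDr : right_distributive dual_scale +%R.
Proof. by move=> a s t; apply: dualP => x /=; rewrite mulrDr. Qed.
Fact dual_scaleDl s : {morph dual_scale^~ s : a b / a + b}.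
Proof. by move=> a b; apply: dualP => x /=; rewrite mulrDl. Qed.
HB.instance Definition _ := GRing.Zmodule_isLmodule.Build k dual
  dual_scaleA dual_scale1 dual_scaleDr dual_scaleDl.

Lemma dualDE (a b : dual) x : (a + b) x = a x + b x. Proof. by []. Qed.
Lemma dualZE (c : k) (a : dual) x : (c *: a) x = c * a x. Proof. by []. Qed.
End Dual.

Section Convolution.
Variables (k : fieldType) (C : coalgType k).
Implicit Types a b c : dual C.

Let conv_fun a b (x : C) : k := sweedler x (fun x1 x2 => a x1 * b x2 : k^o).

Fact conv_bilinear a b :
  bilinear_for *:%R *:%R (fun x y : C => a x * b y : k^o).
Proof.
split=> [y|x] c u v; rewrite linearP.
  by rewrite mulrDl -mulrA.
by rewrite mulrDr mulrCA.
Qed.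

Fact conv_scalar a b : scalar (conv_fun a b).
Proof.
move=> c x y; rewrite /conv_fun /sweedler linearP.
exact: (tliftP (conv_bilinear a b)).
Qed.

Definition conv a b : dual C := mkdual (conv_scalar a b).

Lemma convE a b x : conv a b x = sweedler x (fun x1 x2 => a x1 * b x2 : k^o).
Proof. by []. Qed.

Fact conv_is_bilinear : bilinear_for *:%R *:%R conv.
Proof.
split=> [b|b] c u v; apply: dualP => x; rewrite dualDE dualZE !convE /sweedler;
  rewrite /tlift /tens_eval mulr_sumr -big_split; apply: eq_bigr => p _ /=.
- by rewrite mulrDl mulrA.
- by rewrite mulrDr mulrCA.
Qed.
HB.instance Definition _ := bilinear_isBilinear.Build k (dual C) (dual C) (dual C)
  *:%R *:%R conv conv_is_bilinear.

Fact convA a b c : conv a (conv b c) = conv (conv a b) c.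
Proof.
apply: dualP => x; rewrite !convE /sweedler.
pose T (u : C) (t : tensor C C) : k^o :=
  a u * tlift (fun v w => b v * c w : k^o) t.
have bT : bilinear_for *:%R *:%R T.
  split=> [t|u] d y z; rewrite /T.
    by rewrite linearP mulrDl -mulrA.
  by rewrite (tliftP (conv_bilinear b c)) mulrDr mulrCA.
have := congr1 (tlift T) (coprodA x).
rewrite !tlift_tlift // => e.
transitivity (tlift (fun u v => tlift T (u ⊗ coprod v)) (coprod x)).
  by apply: (@eq_tlift _ _ _ k^o) => u v; rewrite tliftT.
rewrite -e; apply: (@eq_tlift _ _ _ k^o) => u v; rewrite tlift_tlift // convE.
transitivity (tlift (fun u1 u2 => a u1 * b u2 * c v : k^o) (coprod u)).
  apply: (@eq_tlift _ _ _ k^o) => u1 u2; rewrite tliftT // /T tliftT ?mulrA //.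
  exact: conv_bilinear.
by rewrite /sweedler /tlift /tens_eval mulr_suml.
Qed.

HB.instance Definition _ := isAssocAlgebra.Build k (dual C) convA.

Definition conv1 : dual C := counit.
Fact conv1l a : conv conv1 a = a.
Proof.
apply: dualP => x; rewrite convE -[in RHS](counitl x) /sweedler.
rewrite /tlift /tens_eval linear_sum; apply: eq_bigr => p _.
by rewrite linearZ.
Qed.
Fact conv1r a : conv a conv1 = a.
Proof.
apply: dualP => x; rewrite convE -[in RHS](counitr x) /sweedler.
rewrite /tlift /tens_eval linear_sum; apply: eq_bigr => p _.
by rewrite linearZ mulrC.
Qed.
HB.instance Definition _ := isUnitalAlgebra.Build k (dual C) conv1l conv1r.

Lemma dualME a b x : (a ∗ b) x = sweedler x (fun x1 x2 => a x1 * b x2 : k^o).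
Proof. by []. Qed.
Lemma dual1E x : (aone : dual C) x = counit x.
Proof. by []. Qed.

End Convolution.

Section DualActions.
Variables (k : fieldType) (H : hopfAlgType k) (C : coalgType k).

Lemma dual_sumE (I : Type) (r : seq I) (F : I -> dual C) x :
  (\sum_(i <- r) F i) x = \sum_(i <- r) F i x.
Proof.
by elim/big_rec2: _ => // i y z _ <-.
Qed.

Lemma dual_sweedlerE (D : coalgType k) (d : D) (f : D -> D -> dual C) x :
  (sweedler d f) x = sweedler d (fun d1 d2 => f d1 d2 x : k^o).
Proof. exact: dual_sumE. Qed.

Section Act.
Variable act : {bilinear C -> H -> C}.

Fact dual_act_scalar (h : H) (a : dual C) : scalar (fun c => a (act c h)).
Proof. by move=> l x y; rewrite linearPl linearP. Qed.

Definition dual_act (h : H) (a : dual C) : dual C := mkdual (dual_act_scalar h a).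

Lemma dual_actE h a c : dual_act h a c = a (act c h).
Proof. by []. Qed.

Fact dual_act_is_bilinear : bilinear_for *:%R *:%R dual_act.
Proof.
by split=> [a|h] l x y; apply: dualP => c;
  rewrite dualDE dualZE !dual_actE // linearPr linearP.
Qed.
HB.instance Definition _ := bilinear_isBilinear.Build k H (dual C) (dual C)
  *:%R *:%R dual_act dual_act_is_bilinear.

Hypothesis act1 : forall c, act c 1 = c.
Hypothesis act_coprod : forall c h, coprod (act c h) =
  sweedler c (fun c1 c2 => sweedler h (fun h1 h2 => act c1 h1 ⊗ act c2 h2)).

Fact dual_act1 a : dual_act 1 a = a.
Proof. by apply: dualP => c; rewrite dual_actE act1. Qed.

Fact dual_actM h a b : dual_act h (a ∗ b) =
  sweedler h (fun h1 h2 => dual_act h1 a ∗ dual_act h2 b).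
Proof.
apply: dualP => c; rewrite dual_sweedlerE dual_actE dualME.
rewrite {1}/sweedler act_coprod {1}/sweedler tlift_tlift; last exact: conv_bilinear.
transitivity (tlift (fun c1 c2 => tlift (fun h1 h2 =>
    a (act c1 h1) * b (act c2 h2) : k^o) (coprod h)) (coprod c)); last first.
  exact: (@tlift_exchange _ _ _ _ _ k^o).
apply: (@eq_tlift _ _ _ k^o) => c1 c2.
rewrite tlift_tlift; last exact: conv_bilinear.
apply: (@eq_tlift _ _ _ k^o) => h1 h2; rewrite tliftT //.
exact: conv_bilinear.
Qed.
End Act.

Fact dual_actA (ra : module_coalgebra H C) h g a :
  dual_act ra h (dual_act ra g a) = dual_act ra (h * g) a.
Proof. by apply: dualP => c; rewrite !dual_actE mc_actA. Qed.

Definition dual_module_algebra (ra : module_coalgebra H C) :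
    module_algebra H (dual C) :=
  ModuleAlgebra (ma_act := dual_act ra)
    (dual_act1 (mc_act1 ra)) (dual_actM (mc_coprod ra)) (dual_actA ra).

Fact dual_pactA (ra : partial_module_coalgebra H C) h g a :
  dual_act ra h (dual_act ra g a) =
  sweedler h (fun h1 h2 => dual_act ra h1 aone ∗ dual_act ra (h2 * g) a).
Proof.
apply: dualP => c.
rewrite dual_sweedlerE !dual_actE pmc_actA /sweedler.
rewrite (tlift_comp (W' := k^o) (a : {linear C -> k^o})).
transitivity (tlift (fun c1 c2 => tlift (fun h1 h2 =>
    counit (ra c1 h1) * a (ra c2 (h2 * g)) : k^o) (coprod h)) (coprod c)).
  apply: (@eq_tlift _ _ _ k^o) => c1 c2.
  rewrite (tlift_comp (W' := k^o) (a : {linear C -> k^o})).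
  by apply: (@eq_tlift _ _ _ k^o) => h1 h2; rewrite linearZ.
exact: (@tlift_exchange _ _ _ _ _ k^o).
Qed.

Definition dual_partial_module_algebra (ra : partial_module_coalgebra H C) :
    partial_module_algebra H (dual C) :=
  PartialModuleAlgebra (pma_act := dual_act ra)
    (dual_act1 (pmc_act1 ra)) (dual_actM (pmc_coprod ra)) (dual_pactA ra).

End DualActions.

Section Globalization.
Variables (k : fieldType) (H : hopfAlgType k).

Record coalg_mono (C D : coalgType k) := CoalgMono {
  cm_fun :> {linear C -> D};
  cm_inj : injective cm_fun;
  cm_coprod : forall c, coprod (cm_fun c) =
    tlift (fun c1 c2 => cm_fun c1 ⊗ cm_fun c2) (coprod c);
  cm_counit : forall c, counit (cm_fun c) = counit c
}.

Definition ract_span (D : coalgType k) (act : module_coalgebra H D)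
    (X : set D) : set D :=
  lspan [set d | exists x h, X x /\ d = act x h].

Definition lact_span (B : assocAlgType k) (act : module_algebra H B)
    (X : set B) : set B :=
  lspan [set b | exists h x, X x /\ b = act h x].

(* pi is viewed as an endomorphism of D; it need not preserve the counit. *)
Record comult_proj (C D : coalgType k) (theta : coalg_mono C D) := ComultProj {
  cp_fun :> {linear D -> D};
  cp_idem : forall d, cp_fun (cp_fun d) = cp_fun d;
  cp_range : range cp_fun = range theta;
  cp_coprod : forall d, coprod (cp_fun d) =
    tlift (fun d1 d2 => cp_fun d1 ⊗ cp_fun d2) (coprod d)
}.

(* The triple (E, theta, pi) is a globalization of the partial module coalgebra
   C, where E is a subspace of a module coalgebra D, with the structure of D, and
   pi is defined on D. For E = setT this is the notion for D itself.

   In cg_proj, d ranges over the domain D of pi, not only over E. Otherwise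
   nothing would be known of pi outside E = theta(C) ◁ H, while the dual of D
   sees all of D: let H = k[g] with g of order 2, let D have the basis e, x, y of
   grouplike elements, with g fixing e and swapping x and y, and let C = k with
   the trivial action, theta 1 = e, pi e = pi x = e and pi y = 0. Then E = k e
   and the law cg_proj holds for d in E, but not for h = g and d = x. On the dual
   side, ag_induced fails for h = g and a = 1: the left side takes the value 1 at
   x, and the right side the value 0. *)
Record coalg_globalization (C D : coalgType k)
    (pact : partial_module_coalgebra H C) (act : module_coalgebra H D)
    (theta : coalg_mono C D) (pi : comult_proj theta) (E : set D) : Prop :=
  CoalgGlobalization {
  cg_subspace : subspace E;
  cg_coprod : forall d, E d ->
    lspan [set t | exists a b, [/\ E a, E b & t = a ⊗ b]] (coprod d);
  cg_act : forall d h, E d -> E (act d h);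
  cg_theta : range theta `<=` E;
  cg_proj : forall h d, pi (act (pi d) h) =
    pi (act (sweedler d (fun d1 d2 => counit (pi d1) *: d2)) h);
  cg_induced : forall h c, theta (pact c h) = pi (act (theta c) h);
  cg_span : E = ract_span act (range theta)
}.

(* The pair (E, phi) is a globalization of the partial module algebra A, where E
   is a subspace of a module algebra B, with the product and action of B. *)
Record alg_globalization (A : unitalAlgType k) (B : assocAlgType k)
    (pact : partial_module_algebra H A) (act : module_algebra H B)
    (phi : {linear A -> B}) (E : set B) : Prop := AlgGlobalization {
  ag_subspace : subspace E;
  ag_mul : forall x y, E x -> E y -> E (x ∗ y);
  ag_act : forall h x, E x -> E (act h x);
  ag_phi : range phi `<=` E;
  ag_phi_inj : injective phi;
  ag_phiM : forall a b, phi (a ∗ b) = phi a ∗ phi b;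
  ag_ideal : forall x y, range phi x -> E y -> range phi (x ∗ y);
  ag_induced : forall h a, phi (pact h a) = phi aone ∗ act h (phi a);
  ag_span : E = lact_span act (range phi)
}.

Section Phi.
Variables (C D : coalgType k) (theta : coalg_mono C D) (pi : comult_proj theta).

(* theta^-1 \o pi *)
Definition theta_inv_pi (d : D) : C := xget 0 [set c | theta c = pi d].

Lemma theta_inv_piK d : theta (theta_inv_pi d) = pi d.
Proof.
apply: (@xgetPex _ 0 [set c | theta c = pi d]).
have : range pi (pi d) by exists d.
by rewrite cp_range => -[c _ e]; exists c.
Qed.

Fact phi_scalar (a : dual C) : scalar (fun d => a (theta_inv_pi d)).
Proof.
move=> l x y; rewrite -linearP; congr (a _); apply: (@cm_inj _ _ theta).
by rewrite linearP !theta_inv_piK linearP.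
Qed.

Definition dual_phi (a : dual C) : dual D := mkdual (phi_scalar a).

Lemma dual_phiE a d : dual_phi a d = a (theta_inv_pi d).
Proof. by []. Qed.

Fact dual_phi_is_linear : linear dual_phi.
Proof. by move=> l a b; apply: dualP. Qed.
HB.instance Definition _ :=
  GRing.isLinear.Build k (dual C) (dual D) *:%R dual_phi dual_phi_is_linear.

End Phi.
End Globalization.

(* Main.v *)
From HB Require Import structures.
Require Import Defs.
From mathcomp Require Import all_boot all_algebra.
From mathcomp Require Import boolp classical_sets.

(** Write psi = theta^-1 o pi, so that phi is precomposition with psi, and write
    d' = eps(pi d_1) d_2. Both globalization properties are equivalent to the
    single equation
      (1)   psi(d) ↼ h = psi(d' ◁ h)   for all h in H and d in D.

    On the coalgebra side, only the two laws relating pi to the actions have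
    content, the others being true of any span of translates of theta(C). Applied
    to (1), theta gives theta(psi(d) ↼ h) = pi(d' ◁ h). If the two laws hold, the
    left side is pi(pi(d) ◁ h) because theta psi = pi, and (1) is the law for pi.
    Conversely, (1) at d = theta(c), where d' = d, says that pi induces ↼, and
    rewriting the left side of (1) with this gives the law for pi
    ([coalg_laws_iff]).

    On the algebra side, evaluating phi(h ⇀ a) = phi(1)(h ▷ phi(a)) at d gives
    exactly a applied to both sides of (1); as a runs over all of C^*, and linear
    functionals separate the points of C, this is (1) again ([alg_law_iff],
    [dual_separates]). Everything else required of phi follows. Indeed psi is
    comultiplicative and surjective, so phi is multiplicative and injective. By
    phi(a)(h ▷ phi(b)) = phi(a)phi(1)(h ▷ phi(b)) = phi(a(h ⇀ b)), the image of
    phi is a right ideal. Its translates span a subalgebra because of the antipode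
    identity (h ▷ x)(g ▷ y) = h_1 ▷ (x (S(h_2)g ▷ y)) ([ma_mul_act]). *)

Set Implicit Arguments.
Unset Strict Implicit.
Unset Printing Implicit Defensive.
Import GRing.Theory.
Local Open Scope classical_set_scope.
Local Open Scope ring_scope.
Local Open Scope coalg_scope.

(** * Subspaces and linear functionals *)

Section Subspaces.
Variable k : fieldType.
Implicit Types U V W : lmodType k.

Lemma subspaceD V (E : set V) u v : subspace E -> E u -> E v -> E (u + v).
Proof. by move=> [_ El] Eu Ev; rewrite -[u]scale1r; apply: El. Qed.

Lemma subspaceZ V (E : set V) a u : subspace E -> E u -> E (a *: u).
Proof. by move=> [E0 El] Eu; rewrite -[_ *: _]addr0; apply: El. Qed.

Lemma subspaceB V (E : set V) u v : subspace E -> E u -> E v -> E (u - v).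
Proof.
by move=> sE Eu Ev; rewrite -scaleN1r; apply: subspaceD => //; apply: subspaceZ.
Qed.

Lemma subspace_lspan V (X : set V) : subspace (lspan X).
Proof.
split; first by exists [::]; rewrite big_nil.
move=> a _ _ [s [Xs ->]] [t [Xt ->]].
exists ([seq (a * p.1, p.2) | p <- s] ++ t); split.
  move=> p; rewrite mem_cat => /orP[/mapP[q qs ->]|]; first exact: (Xs q).
  exact: Xt.
rewrite big_cat big_map scaler_sumr; congr (_ + _).
by apply: eq_bigr => p _; rewrite scalerA.
Qed.

Lemma sub_lspan V (X : set V) : X `<=` lspan X.
Proof.
move=> x Xx; exists [:: (1, x)]; rewrite big_seq1 scale1r; split=> // p.
by rewrite inE => /eqP ->.
Qed.

Lemma lspan_min V (X E : set V) : subspace E -> X `<=` E -> lspan X `<=` E.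
Proof.
move=> sE XE _ [s [Xs ->]]; rewrite big_seq; elim/big_rec: _ => [|p x ps Ex].
  by case: sE.
by apply: (proj2 sE) => //; apply/XE/Xs.
Qed.

Lemma subspace_tlift U V W (E : set W) (f : U -> V -> W) t :
  subspace E -> (forall u v, E (f u v)) -> E (tlift f t).
Proof.
move=> sE Ef; rewrite /tlift /tens_eval; elim/big_rec: _ => [|p x _ Ex].
  by case: sE.
exact: subspaceD.
Qed.

Lemma subspace_preim V W (f : V -> W) (E : set W) :
  linear f -> subspace E -> subspace [set v | E (f v)].
Proof.
move=> lf [E0 El]; split=> [|a u v Eu Ev] /=; last by rewrite lf; apply: El.
have := lf (- 1) 0 0; rewrite scaleN1r oppr0 addr0 => ->.
by rewrite scaleN1r addNr.
Qed.

Lemma subspace_range V W (f : {linear V -> W}) : subspace (range f).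
Proof.
split=> [|a _ _ [u _ <-] [v _ <-]]; first by exists 0; rewrite ?linear0.
by exists (a *: u + v); rewrite ?linearP.
Qed.

Lemma tlift_linear U V W W' (g : W -> W') (f : U -> V -> W) t :
  linear g -> g (tlift f t) = tlift (fun u v => g (f u v)) t.
Proof.
move=> lg; pose m := GRing.isLinear.Build k _ _ _ _ lg.
pose G : {linear W -> W'} := HB.pack g m.
exact: (tlift_comp G).
Qed.

(** Bilinear maps separate the elements of a tensor product, so it suffices to
    compare both sides under every bilinear f. *)
Lemma tlift_tens_id U V (t : tensor U V) : tlift (fun u v => u ⊗ v) t = t.
Proof.
apply: tensor_ext => W f.
have bf : bilinear_for *:%R *:%R f.
  by split=> [v|u] a x y; rewrite ?linearPl ?linearPr.
by rewrite tlift_tlift //; apply: eq_tlift => u v; rewrite tlift_tens.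
Qed.

Lemma bilinear_tlift U V U' V' W (f : U -> V -> U' -> V' -> W) t :
  (forall c d, bilinear_for *:%R *:%R (fun a b => f a b c d)) ->
  bilinear_for *:%R *:%R (fun a b => tlift (f a b) t).
Proof.
move=> bf; split=> [b|a] l x y; rewrite /= /tlift /tens_eval scaler_sumr -big_split;
  by apply: eq_bigr => p _ /=; case: (bf p.1 p.2) => fl fr; rewrite ?fl ?fr.
Qed.

(** By Zorn's lemma there is a subspace M maximal among those avoiding v. If u is
    outside M, then M + ku contains v, which can be solved for u modulo M. *)
Lemma exists_hyperplane V (v : V) : v <> 0 ->
  exists M : set V, [/\ subspace M, ~ M v & forall u, exists a, M (u - a *: v)].
Proof.
move=> v0; pose lin (M : set V) := forall a u w, M u -> M w -> M (a *: u + w).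
(* Closure under combinations is required here without 0 in M, so that the empty
   union is a legitimate upper bound of the empty chain. *)
have [F Fsub Ftot|M [[Ml Mv] Mmax]] := @Zorn_bigcup V [set M | lin M /\ ~ M v].
  split=> [a u w [M FM Mu] [N FN Nw]|[M FM Mv]]; last by case: (Fsub M FM).
  have [MN|NM] := Ftot M N FM FN.
    by exists N => //; apply: (Fsub N FN).1 => //; apply: MN.
  by exists M => //; apply: (Fsub M FM).1 => //; apply: NM.
have M0 : M 0.
  apply: contrapT => nM0; apply: (Mmax [set 0]).
    split=> [w Mw|/(_ 0 erefl)//].
    by case: nM0; rewrite -(addNr w) -scaleN1r; apply: Ml.
  by split=> // a u w -> ->; rewrite scaler0 addr0.
have sM : subspace M by split.
exists M; split=> // u; have [Mu|nMu] := pselect (M u).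
  by exists 0; rewrite scale0r subr0.
pose N := [set w | exists m b, M m /\ w = m + b *: u].
have MN : M `<=` N by move=> w Mw; exists w, 0; rewrite scale0r addr0.
have [m [b [Mm vE]]] : N v.
  apply: contrapT => nNv; apply: (Mmax N).
    split=> // /(_ u) NM; apply: nMu; apply: NM.
    by exists 0, 1; rewrite scale1r add0r.
  split=> // a _ _ [m [b [Mm ->]]] [n [c [Mn ->]]].
  exists (a *: m + n), (a * b + c); split; first exact: Ml.
  by rewrite scalerDr scalerA addrACA -scalerDl.
have b0 : b != 0.
  by apply/eqP => b0; apply: Mv; rewrite vE b0 scale0r addr0.
exists b^-1; rewrite vE scalerDr scalerA mulVf // scale1r opprD addrCA subrr addr0.
by rewrite -scaleNr; apply: subspaceZ.
Qed.

(** The functional that distinguishes x from y is the coordinate along x - y with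
    respect to a complementary hyperplane. *)
Lemma dual_separates V (x y : V) : (forall f : dual V, f x = f y) -> x = y.
Proof.
move=> fxy; apply: contrapT => xy.
have [|M [sM Mv Mcod]] := @exists_hyperplane V (x - y).
  by move/eqP; rewrite subr_eq0 => /eqP.
pose f u := sval (cid (Mcod u)).
have fP u : M (u - f u *: (x - y)) by rewrite /f; case: cid.
have f_uniq u a : M (u - a *: (x - y)) -> f u = a.
  move=> Ma; apply/eqP; rewrite -subr_eq0; apply: contrapT => /negP fa.
  have := subspaceB sM Ma (fP u).
  rewrite opprB addrC addrA subrK -scalerBl => /(subspaceZ (f u - a)^-1 sM).
  by rewrite scalerA mulVf // scale1r.
have lf : scalar f.
  move=> a u w; apply: f_uniq.
  rewrite scalerDl opprD addrACA -scalerA -scalerBr.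
  by apply: (proj2 sM).
have : f (x - y) = 1 by apply: f_uniq; rewrite scale1r subrr; case: sM.
have /= fxyE := fxy (mkdual lf).
have -> : f (x - y) = f x - f y.
  by have := raddfB (mkdual lf) x y.
by rewrite fxyE subrr => /esym/eqP; rewrite oner_eq0.
Qed.

End Subspaces.

(** * Products in a module algebra *)

Section ModuleAlgebra.
Variables (k : fieldType) (H : hopfAlgType k) (B : assocAlgType k).
Variable act : module_algebra H B.

(** The right side is (h_1 ▷ a)(h_2 S(h_3) g ▷ b) by multiplicativity of the action
    and coassociativity, and h_2 S(h_3) collapses to a counit. *)
Lemma ma_mul_act h g (a b : B) : act h a ∗ act g b =
  sweedler h (fun h1 h2 => act h1 (a ∗ act (antipode h2 * g) b)).
Proof.
(* T u (v ⊗ w) is (u ▷ a)(v S(w) g ▷ b); both sides are T applied to the iterated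
   coproduct of h, bracketed in the two possible ways. *)
pose q (t : tensor H H) := tlift (fun v w => act (v * antipode w * g) b) t.
have bq : bilinear_for *:%R *:%R (fun v w => act (v * antipode w * g) b).
  split=> [w|v] c x y.
    by rewrite !mulrDl -!scalerAl linearPl.
  by rewrite linearP mulrDr mulrDl -scalerAr -scalerAl linearPl.
pose T u t := act u a ∗ q t.
have bT : bilinear_for *:%R *:%R T.
  split=> [t|u] c x y; rewrite /T; first by rewrite linearPl linearPl.
  by rewrite /q (tliftP bq) linearPr.
transitivity (tlift (fun u v => T u (coprod v)) (coprod h)).
  rewrite -{1}(counitr h) (tlift_linear (g := fun h => act h a ∗ _)); last first.
    by move=> c x y; rewrite linearPl linearPl.
  apply: eq_tlift => u v; rewrite /T /q linearZl_LR linearZl_LR -linearZr_LR /=.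
  congr (_ ∗ _); rewrite -(tlift_linear (g := fun h => act (h * g) b)); last first.
    by move=> c x y; rewrite mulrDl -scalerAl linearPl.
  by rewrite -/(sweedler _ _) antipoder -scalerAl mul1r linearZl_LR.
transitivity (tlift (fun u v => tlift T (u ⊗ coprod v)) (coprod h)).
  by apply: eq_tlift => u v; rewrite tliftT.
rewrite -tlift_tlift // -coprodA tlift_tlift //; apply: eq_tlift => h1 h2.
rewrite tlift_tlift // ma_actM; apply: eq_tlift => u v.
by rewrite tliftT // /T /q tliftT // ma_actA mulrA.
Qed.

End ModuleAlgebra.

(** * The equation behind both globalization properties *)

Section Intertwining.
Variables (k : fieldType) (H : hopfAlgType k) (C D : coalgType k).
Variables (pact : partial_module_coalgebra H C) (act : module_coalgebra H D).
Variables (theta : coalg_mono C D) (pi : comult_proj theta).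

Notation psi := (theta_inv_pi pi).
Notation phi := (dual_phi pi).

Lemma pi_theta c : pi (theta c) = theta c.
Proof.
have : range theta (theta c) by exists c.
by rewrite -(cp_range pi) => -[d _ <-]; rewrite cp_idem.
Qed.

Lemma theta_inv_pi_theta c : psi (theta c) = c.
Proof. by apply: (@cm_inj _ _ _ theta); rewrite theta_inv_piK pi_theta. Qed.

Lemma theta_inv_pi_pi d : psi (pi d) = psi d.
Proof. by rewrite -(theta_inv_piK pi d) theta_inv_pi_theta. Qed.

Lemma theta_inv_pi_linear : linear psi.
Proof.
move=> a x y; apply: (@cm_inj _ _ _ theta).
by rewrite linearP !theta_inv_piK linearP.
Qed.

Lemma counit_theta_inv_pi d : counit (psi d) = counit (pi d).
Proof. by rewrite -(cm_counit theta) theta_inv_piK. Qed.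

(** Apply psi ⊗ psi to (theta ⊗ theta)(Delta(psi d)) = Delta(pi d) =
    (pi ⊗ pi)(Delta d), and use psi theta = id and psi pi = psi: having a left
    inverse psi for theta dispenses with the injectivity of theta ⊗ theta. *)
Lemma coprod_theta_inv_pi d :
  coprod (psi d) = sweedler d (fun d1 d2 => psi d1 ⊗ psi d2).
Proof.
have bpsi : bilinear_for *:%R *:%R (fun u v => psi u ⊗ psi v).
  by split=> [v|u] a x y; rewrite theta_inv_pi_linear ?linearPl ?linearPr.
have := cm_coprod theta (psi d).
rewrite theta_inv_piK cp_coprod => /(congr1 (tlift (fun u v => psi u ⊗ psi v))).
rewrite !tlift_tlift //.
under eq_tlift do rewrite tliftT // !theta_inv_pi_pi.
under [RHS]eq_tlift do rewrite tliftT // !theta_inv_pi_theta.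
by rewrite tlift_tens_id.
Qed.

Definition pi_counit_part d := sweedler d (fun d1 d2 => counit (pi d1) *: d2).

(** Since pi fixes theta(C) and theta preserves the counit, this is the counit law
    of C carried over by theta. *)
Lemma pi_counit_part_theta c : pi_counit_part (theta c) = theta c.
Proof.
have b : bilinear_for *:%R *:%R (fun u v : D => counit (pi u) *: v).
  split=> [v|u] a x y; first by rewrite !linearP scalerDl -scalerA.
  by rewrite /= scalerDr !scalerA [a * _]mulrC.
rewrite /pi_counit_part /sweedler cm_coprod tlift_tlift //.
rewrite -{2}(counitl c) tlift_comp; apply: eq_tlift => c1 c2.
by rewrite tliftT // pi_theta cm_counit linearZ.
Qed.

Definition psi_intertwines :=
  forall h d, pact (psi d) h = psi (act (pi_counit_part d) h).

Lemma coalg_laws_iff :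
  (forall h d, pi (act (pi d) h) = pi (act (pi_counit_part d) h)) /\
  (forall h c, theta (pact c h) = pi (act (theta c) h)) <->
  psi_intertwines.
Proof.
split=> [[proj ind] h d|law].
  apply: (@cm_inj _ _ _ theta).
  by rewrite ind !theta_inv_piK -proj.
have ind h c : theta (pact c h) = pi (act (theta c) h).
  rewrite -{1}(theta_inv_pi_theta c) law theta_inv_piK.
  by rewrite pi_counit_part_theta.
split=> // h d.
by rewrite -(theta_inv_piK pi d) -ind law theta_inv_piK.
Qed.

(** Both sides of the first law, evaluated at d, are the functional a evaluated at
    the two sides of the second, so separation of points by functionals turns the
    law on the duals into the law on the coalgebras. *)
Lemma alg_law_iff :
  (forall h a, phi (dual_partial_module_algebra pact h a) =
     phi aone ∗ dual_module_algebra act h (phi a)) <->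
  psi_intertwines.
Proof.
have rhsE h (a : dual C) d :
    (phi aone ∗ dual_module_algebra act h (phi a)) d =
    a (psi (act (pi_counit_part d) h)).
  have lg : scalar (fun d => a (psi (act d h))).
    by move=> l x y; rewrite linearPl theta_inv_pi_linear linearP.
  pose g := mkdual lg; rewrite -[RHS]/(g _) (tlift_comp (W' := k^o) g).
  apply: (@eq_tlift _ _ _ k^o) => d1 d2.
  by rewrite linearZ dual_phiE dual1E counit_theta_inv_pi.
split=> [law h d|law h a].
  by apply: dual_separates => a; rewrite -rhsE -law.
by apply: dualP => d; rewrite rhsE -law.
Qed.

Lemma dual_phi_inj : injective phi.
Proof.
by move=> a b e; apply: dualP => c; rewrite -(theta_inv_pi_theta c) -!dual_phiE e.
Qed.

Lemma dual_phiM a b : phi (a ∗ b) = phi a ∗ phi b.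
Proof.
apply: dualP => d; rewrite dual_phiE !dualME /sweedler coprod_theta_inv_pi /sweedler.
rewrite tlift_tlift; last exact: conv_bilinear.
apply: (@eq_tlift _ _ _ k^o) => d1 d2; rewrite tliftT //; exact: conv_bilinear.
Qed.

End Intertwining.

(** * Spans of translates and the two characterizations *)

Section Globalizations.
Variables (k : fieldType) (H : hopfAlgType k).

(** On a generator, Delta(theta(c) ◁ h) is
    (theta(c_1) ◁ h_1) ⊗ (theta(c_2) ◁ h_2). *)
Lemma coprod_ract_span (C D : coalgType k) (act : module_coalgebra H D)
    (theta : coalg_mono C D) d : let E := ract_span act (range theta) in
  E d -> lspan [set t | exists a b, [/\ E a, E b & t = a ⊗ b]] (coprod d).
Proof.
move=> E; apply: (lspan_min (E := [set d | lspan _ (coprod d)])).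
  apply: (subspace_preim (f := coprod)); last exact: subspace_lspan.
  by move=> a x y; rewrite linearP.
move=> _ [_ [h [[c _ <-] ->]]] /=; rewrite mc_coprod /sweedler cm_coprod.
have gen b g : E (act (theta b) g).
  by apply: sub_lspan; exists (theta b), g; split=> //; exists b.
have bil : bilinear_for *:%R *:%R (fun d1 d2 =>
    tlift (fun h1 h2 => act d1 h1 ⊗ act d2 h2) (coprod h)).
  apply: bilinear_tlift => h1 h2.
  by split=> [v|u] a x y; rewrite linearPl ?(linearPl, linearPr).
rewrite tlift_tlift //.
apply: subspace_tlift => [|c1 c2]; first exact: subspace_lspan.
rewrite tliftT //; apply: subspace_tlift => [|h1 h2]; first exact: subspace_lspan.
by apply: sub_lspan; exists (act (theta c1) h1), (act (theta c2) h2); split.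
Qed.

Lemma ract_span_act (D : coalgType k) (act : module_coalgebra H D) (X : set D)
    d h : ract_span act X d -> ract_span act X (act d h).
Proof.
apply: (lspan_min (E := [set d | ract_span act X (act d h)])).
  apply: (subspace_preim (f := fun d => act d h)); last exact: subspace_lspan.
  by move=> a x y; rewrite linearPl.
move=> _ [x [g [Xx ->]]] /=; apply: sub_lspan.
by exists x, (g * h); rewrite mc_actA.
Qed.

Lemma sub_ract_span (D : coalgType k) (act : module_coalgebra H D) (X : set D) :
  X `<=` ract_span act X.
Proof. by move=> x Xx; apply: sub_lspan; exists x, 1; rewrite mc_act1. Qed.

Lemma lact_span_act (B : assocAlgType k) (act : module_algebra H B) (X : set B)
    h x : lact_span act X x -> lact_span act X (act h x).
Proof.
apply: (lspan_min (E := [set x | lact_span act X (act h x)])).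
  apply: (subspace_preim (f := act h)); last exact: subspace_lspan.
  by move=> a y z; rewrite linearPr.
move=> _ [g [y [Xy ->]]] /=; apply: sub_lspan.
by exists (h * g), y; rewrite ma_actA.
Qed.

Lemma sub_lact_span (B : assocAlgType k) (act : module_algebra H B) (X : set B) :
  X `<=` lact_span act X.
Proof. by move=> x Xx; apply: sub_lspan; exists 1, x; rewrite ma_act1. Qed.

Section RightIdeal.
Variables (B : assocAlgType k) (act : module_algebra H B) (X : set B).
Hypothesis mulX_act : forall x h y, X x -> X y -> X (x ∗ act h y).

Lemma mul_lact_span_ideal : subspace X ->
  forall x y, X x -> lact_span act X y -> X (x ∗ y).
Proof.
move=> sX x y Xx; apply: (lspan_min (E := [set y | X (x ∗ y)])).
  apply: (subspace_preim (f := amul x)) => //.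
  by move=> a u v; rewrite linearPr.
by move=> _ [h [z [Xz ->]]]; apply: mulX_act.
Qed.

(** [ma_mul_act] writes a product of two translates of X as a sum of translates of
    products x (k ▷ y), which lie in X. *)
Lemma mul_lact_span x y :
  lact_span act X x -> lact_span act X y -> lact_span act X (x ∗ y).
Proof.
move=> Ex Ey; move: x Ex.
apply: (lspan_min (E := [set x | lact_span act X (x ∗ y)])).
  apply: (subspace_preim (f := amul^~ y)); last exact: subspace_lspan.
  by move=> a u v; rewrite linearPl.
move=> _ [h [a [Xa ->]]] /=; move: y Ey.
apply: (lspan_min (E := [set y | lact_span act X (_ ∗ y)])).
  apply: (subspace_preim (f := amul _)); last exact: subspace_lspan.
  by move=> l u v; rewrite linearPr.
move=> _ [g [b [Xb ->]]] /=; rewrite ma_mul_act.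
apply: subspace_tlift => [|h1 h2]; first exact: subspace_lspan.
by apply: sub_lspan; exists h1, (a ∗ act (antipode h2 * g) b); split; auto.
Qed.
End RightIdeal.

Lemma coalg_globalizationP (C D : coalgType k)
    (pact : partial_module_coalgebra H C) (act : module_coalgebra H D)
    (theta : coalg_mono C D) (pi : comult_proj theta) :
  coalg_globalization pact act pi (ract_span act (range theta)) <->
  psi_intertwines pact act pi.
Proof.
split=> [[? ? ? ? proj ind _]|/coalg_laws_iff[proj ind]].
  by apply/coalg_laws_iff.
split=> //.
- exact: subspace_lspan.
- exact: coprod_ract_span.
- by move=> d h; apply: ract_span_act.
- exact: sub_ract_span.
Qed.

Lemma alg_globalizationP (C D : coalgType k)
    (pact : partial_module_coalgebra H C) (act : module_coalgebra H D)
    (theta : coalg_mono C D) (pi : comult_proj theta) :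
  alg_globalization (dual_partial_module_algebra pact) (dual_module_algebra act)
    (dual_phi pi)
    (lact_span (dual_module_algebra act) (range (dual_phi pi))) <->
  psi_intertwines pact act pi.
Proof.
split=> [[? ? ? ? ? ? ? ind _]|/alg_law_iff ind]; first exact/alg_law_iff.
(* phi(a) = phi(a)phi(1) makes room for the induced action of h on phi(b). *)
have mulr_act x h y : range (dual_phi pi) x -> range (dual_phi pi) y ->
    range (dual_phi pi) (x ∗ dual_module_algebra act h y).
  move=> [a _ <-] [b _ <-].
  exists (a ∗ dual_partial_module_algebra pact h b) => //.
  by rewrite dual_phiM ind amulA -dual_phiM amul1r.
split=> //.
- exact: subspace_lspan.
- exact: mul_lact_span.
- by move=> h x; apply: lact_span_act.
- exact: sub_lact_span.
- exact: dual_phi_inj.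
- exact: dual_phiM.
- by apply: mul_lact_span_ideal => //; apply: subspace_range.
Qed.

End Globalizations.

Theorem theorem3p23 (k : fieldType) (H : hopfAlgType k) (C D : coalgType k)
    (pact : partial_module_coalgebra H C) (act : module_coalgebra H D)
    (theta : coalg_mono C D) (pi : comult_proj theta) :
  coalg_globalization pact act pi (ract_span act (range theta)) <->
  alg_globalization (dual_partial_module_algebra pact) (dual_module_algebra act)
    (dual_phi pi)
    (lact_span (dual_module_algebra act) (range (dual_phi pi))).
Proof.
by rewrite coalg_globalizationP alg_globalizationP.
Qed.
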